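(* Let $q$ be not a root of unity. The representations $R^{(\mathrm i,+)}_n$, $R^{(\mathrm i,-)}_n$, $R^{(-\mathrm i,+)}_n$ and $R^{(-\mathrm i,-)}_n$ ($n=1,2,3,\dots$) of $U_q(\mathrm{so}_3)$ are irreducible and pairwise nonequivalent. For any $l\in\{0,\frac12,1,\frac32,\dots\}$ the representation $R^{(1)}_l$ is not equivalent to any of these representations.
   Context: $q\in\mathbf C$, $q\ne0$, with a fixed square root $q^{1/2}$; $\mathrm i=\sqrt{-1}$; $[a]=\frac{q^a-q^{-a}}{q-q^{-1}}$. $U_q(\mathrm{so}_3)$ is the unital associative complex algebra generated by $I_1,I_2,I_3$ with defining relations $q^{1/2}I_1I_2-q^{-1/2}I_2I_1=I_3$, $q^{1/2}I_2I_3-q^{-1/2}I_3I_2=I_1$, $q^{1/2}I_3I_1-q^{-1/2}I_1I_3=I_2$. A representation $R$ is determined by $R(I_1)$ and $R(I_2)$, since $R(I_3)=q^{1/2}R(I_1)R(I_2)-q^{-1/2}R(I_2)R(I_1)$. $R_l^{(1)}$ acts on the space with basis $|m\rangle$, $m=-l,-l+1,\dots,l$, by $R_l^{(1)}(I_1)|m\rangle=\mathrm i[m]\,|m\rangle$, $R_l^{(1)}(I_2)|m\rangle=\frac{1}{q^m+q^{-m}}\{[l-m]\,|m+1\rangle-[l+m]\,|m-1\rangle\}$. For $n=1,2,3,\dots$ the representations $R_n^{(\pm\mathrm i,\pm)}$ act on the $n$-dimensional space with basis $|1\rangle,\dots,|n\rangle$ by (terms with the vector $|n+1\rangle$ have coefficient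 $[0]=0$) $$R_n^{(\mathrm i,\pm)}(I_1)|k\rangle=-\frac{q^{k-1/2}+q^{-k+1/2}}{q-q^{-1}}|k\rangle,$$ $$R_n^{(\mathrm i,\pm)}(I_2)|1\rangle=\pm\frac{[n]}{q^{1/2}-q^{-1/2}}|1\rangle+\mathrm i\frac{[n-1]}{q^{1/2}-q^{-1/2}}|2\rangle,$$ $$R_n^{(\mathrm i,\pm)}(I_2)|k\rangle=\mathrm i\frac{[n-k]}{q^{k-1/2}-q^{-k+1/2}}|k+1\rangle+\mathrm i\frac{[n+k-1]}{q^{k-1/2}-q^{-k+1/2}}|k-1\rangle,\quad k\ne1,$$ and $R_n^{(-\mathrm i,\pm)}(I_1)=-R_n^{(\mathrm i,\pm)}(I_1)$, $R_n^{(-\mathrm i,\pm)}(I_2)=-R_n^{(\mathrm i,\pm)}(I_2)$. *)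

(* Defs.v *)
From HB Require Import structures.
From mathcomp Require Import all_boot all_order all_algebra.
From mathcomp Require Import generic_quotient ring_quotient.
From mathcomp Require Import boolp monalg.
From mathcomp Require Import ring.
Set Implicit Arguments.
Unset Strict Implicit.
Unset Printing Implicit Defensive.
Import Order.TTheory GRing.Theory Num.Theory.
Local Open Scope ring_scope.
Local Open Scope quotient_scope.

Section TwoSidedIdeal.
Variables (C : fieldType) (F : algType C) (rels : seq F).

Definition span_ideal : {pred F} := fun x =>
  `[< exists s : seq (F * F * F),
        all (fun t => t.1.2 \in rels) s
        /\ x = \sum_(t <- s) t.1.1 * t.1.2 * t.2 >].

Lemma span_idealP x : reflect (exists s : seq (F * F * F),
        all (fun t => t.1.2 \in rels) s
        /\ x = \sum_(t <- s) t.1.1 * t.1.2 * t.2) (x \in span_ideal).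
Proof. exact: asboolP. Qed.

Lemma span_idealM a b x : x \in span_ideal -> a * x * b \in span_ideal.
Proof.
case/span_idealP => s [hs ->]; apply/span_idealP.
exists [seq (a * t.1.1, t.1.2, t.2 * b) | t <- s]; split.
  by rewrite all_map; apply: sub_all hs.
rewrite big_map mulr_sumr mulr_suml; apply: eq_bigr => t _ /=.
by rewrite !mulrA.
Qed.

Lemma span_idealD x y :
  x \in span_ideal -> y \in span_ideal -> x + y \in span_ideal.
Proof.
case/span_idealP => s [hs ->]; case/span_idealP => t [ht ->]; apply/span_idealP.
by exists (s ++ t); rewrite all_cat hs ht big_cat.
Qed.

Lemma span_ideal_zmod : zmod_closed span_ideal.
Proof.
split=> [|x y hx hy].
  by apply/span_idealP; exists [::]; rewrite big_nil.
apply: span_idealD => //.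
by have := span_idealM (-1) 1 hy; rewrite mulN1r mulr1.
Qed.

HB.instance Definition _ :=
  GRing.isZmodClosed.Build F span_ideal span_ideal_zmod.

Lemma span_ideal_rel r : r \in rels -> r \in span_ideal.
Proof.
move=> hr; apply/span_idealP; exists [:: (1, r, 1)].
by rewrite /= hr big_seq1 /= mul1r mulr1.
Qed.

Lemma span_ideal_ker (A : algType C) (f : {rmorphism F -> A}) :
  {in rels, forall r, f r = 0} -> {in span_ideal, forall x, f x = 0}.
Proof.
move=> hf x /span_idealP[s [/allP hs ->]].
rewrite raddf_sum big_seq big1 // => t ts.
by rewrite /= !rmorphM /= (hf _ (hs _ ts)) mulr0 mul0r.
Qed.

End TwoSidedIdeal.

Section AlgebraQuotient.
Variables (C : fieldType) (F : algType C) (rels : seq F).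
Local Notation I := (span_ideal rels).

(* The argument makes the quotient a nonzero ring, as algType requires. *)
Definition alg_quot (_ : 1 \notin I) : Type := {ideal_quot I}.

Hypothesis I1 : 1 \notin I.
Local Notation Q := (alg_quot I1).

HB.instance Definition _ := GRing.Zmodule.on Q.

Definition alg_pi : F -> Q := \pi_{ideal_quot I}.
Definition alg_repr (u : Q) : F := repr (u : {ideal_quot I}).

Lemma alg_piP x y : reflect (alg_pi x = alg_pi y) (x - y \in I).
Proof. rewrite (Quotient.idealrBE I); exact: eqP. Qed.

Lemma alg_piK (u : Q) : alg_pi (alg_repr u) = u.
Proof. exact: reprK. Qed.

Lemma alg_piB : zmod_morphism alg_pi.
Proof. exact: (raddfB (\pi_{ideal_quot I})). Qed.
HB.instance Definition _ := GRing.isZmodMorphism.Build F Q alg_pi alg_piB.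

Let qone : Q := alg_pi 1.
Let qmul (u v : Q) : Q := alg_pi (alg_repr u * alg_repr v).
Let qscale (c : C) (u : Q) : Q := alg_pi (c *: alg_repr u).

Lemma alg_reprB x : alg_repr (alg_pi x) - x \in I.
Proof. by apply/alg_piP; rewrite alg_piK. Qed.

Let qpiM x y : alg_pi (x * y) = qmul (alg_pi x) (alg_pi y).
Proof.
apply/esym/alg_piP.
have -> : alg_repr (alg_pi x) * alg_repr (alg_pi y) - x * y
   = 1 * (alg_repr (alg_pi x) - x) * alg_repr (alg_pi y)
   + x * (alg_repr (alg_pi y) - y) * 1.
  by rewrite mul1r mulr1 mulrBl mulrBr addrA subrK.
by apply: span_idealD; apply: span_idealM; apply: alg_reprB.
Qed.

Let qpiZ c x : alg_pi (c *: x) = qscale c (alg_pi x).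
Proof.
apply/esym/alg_piP; rewrite -scalerBr -[_ - x]mulr1 -[_ * 1]mul1r.
rewrite [1 * _]mulrA scalerAl scalerAl.
by apply: span_idealM; apply: alg_reprB.
Qed.

Lemma alg_quot_ind (P : Q -> Prop) : (forall x, P (alg_pi x)) -> forall u, P u.
Proof. by move=> H u; rewrite -[u]alg_piK. Qed.

Let qmulA : associative qmul.
Proof.
elim/alg_quot_ind => x; elim/alg_quot_ind => y; elim/alg_quot_ind => z.
by rewrite -!qpiM mulrA.
Qed.
Let qmul1 : left_id qone qmul.
Proof. by elim/alg_quot_ind => x; rewrite -qpiM mul1r. Qed.
Let qmulr1 : right_id qone qmul.
Proof. by elim/alg_quot_ind => x; rewrite -qpiM mulr1. Qed.
Let qmulDl : left_distributive qmul +%R.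
Proof.
elim/alg_quot_ind => x; elim/alg_quot_ind => y; elim/alg_quot_ind => z.
by rewrite -raddfD -!qpiM mulrDl raddfD.
Qed.
Let qmulDr : right_distributive qmul +%R.
Proof.
elim/alg_quot_ind => x; elim/alg_quot_ind => y; elim/alg_quot_ind => z.
by rewrite -raddfD -!qpiM mulrDr raddfD.
Qed.
Let qone_neq0 : qone != 0.
Proof.
apply/eqP; rewrite /qone -(raddf0 alg_pi) => /alg_piP.
by rewrite subr0 (negPf I1).
Qed.
HB.instance Definition _ := GRing.Zmodule_isNzRing.Build Q
  qmulA qmul1 qmulr1 qmulDl qmulDr qone_neq0.

Let qscaleA a b v : qscale a (qscale b v) = qscale (a * b) v.
Proof. by elim/alg_quot_ind: v => x; rewrite -!qpiZ scalerA. Qed.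
Let qscale1 : left_id 1 qscale.
Proof. by elim/alg_quot_ind => x; rewrite -qpiZ scale1r. Qed.
Let qscaleDr : right_distributive qscale +%R.
Proof.
move=> c; elim/alg_quot_ind => x; elim/alg_quot_ind => y.
by rewrite -raddfD -!qpiZ scalerDr raddfD.
Qed.
Let qscaleDl v : {morph qscale^~ v : a b / a + b}.
Proof.
move=> a b; elim/alg_quot_ind: v => x.
by rewrite -!qpiZ scalerDl raddfD.
Qed.
HB.instance Definition _ := GRing.Zmodule_isLmodule.Build C Q
  qscaleA qscale1 qscaleDr qscaleDl.

Let qscaleAl (c : C) (u v : Q) : qscale c (qmul u v) = qmul (qscale c u) v.
Proof.
elim/alg_quot_ind: u => x; elim/alg_quot_ind: v => y.
by rewrite -(qpiZ c x) -!qpiM -qpiZ scalerAl.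
Qed.
HB.instance Definition _ := GRing.Lmodule_isLalgebra.Build C Q qscaleAl.

Let qscaleAr (c : C) (u v : Q) : qscale c (qmul u v) = qmul u (qscale c v).
Proof.
elim/alg_quot_ind: u => x; elim/alg_quot_ind: v => y.
by rewrite -(qpiZ c y) -!qpiM -qpiZ scalerAr.
Qed.
HB.instance Definition _ := GRing.Lalgebra_isAlgebra.Build C Q qscaleAr.

Lemma alg_pi_monoid : monoid_morphism alg_pi.
Proof. by split => // x y; exact: qpiM. Qed.
HB.instance Definition _ :=
  GRing.isMonoidMorphism.Build F Q alg_pi alg_pi_monoid.

Lemma alg_piZ : scalable alg_pi.
Proof. exact: qpiZ. Qed.
HB.instance Definition _ := GRing.isScalable.Build C F Q *:%R alg_pi alg_piZ.

Lemma alg_pi_rel r : r \in rels -> alg_pi r = 0.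
Proof.
by move=> /span_ideal_rel hr; rewrite -(raddf0 alg_pi); apply/alg_piP; rewrite subr0.
Qed.

Section Lift.
Variables (A : algType C) (f : {lrmorphism F -> A}).
Hypothesis fr : {in rels, forall r, f r = 0}.

Definition quot_lift_fun of {in rels, forall r, f r = 0} :=
  fun u : Q => f (alg_repr u).
Local Notation g := (quot_lift_fun fr).

Lemma quot_lift_pi x : g (alg_pi x) = f x.
Proof.
apply/eqP; rewrite -subr_eq0 -raddfB; apply/eqP.
by apply: (span_ideal_ker fr); apply: alg_reprB.
Qed.

Lemma quot_lift_zmod : zmod_morphism g.
Proof.
elim/alg_quot_ind => x; elim/alg_quot_ind => y.
by rewrite -alg_piB !quot_lift_pi raddfB.
Qed.
HB.instance Definition _ := GRing.isZmodMorphism.Build Q A g quot_lift_zmod.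

Lemma quot_lift_monoid : monoid_morphism g.
Proof.
split; first by rewrite -(rmorph1 alg_pi) quot_lift_pi rmorph1.
elim/alg_quot_ind => x; elim/alg_quot_ind => y.
by rewrite -rmorphM !quot_lift_pi rmorphM.
Qed.
HB.instance Definition _ := GRing.isMonoidMorphism.Build Q A g quot_lift_monoid.

Lemma quot_liftZ : scalable g.
Proof.
by move=> c; elim/alg_quot_ind => x; rewrite -linearZ !quot_lift_pi linearZ.
Qed.
HB.instance Definition _ := GRing.isScalable.Build C Q A *:%R g quot_liftZ.

Definition quot_lift : {lrmorphism Q -> A} := g.

End Lift.
End AlgebraQuotient.

Section FreeAlgebra.
Variable C : fieldType.

(* C<I_1, I_2, I_3>, as the algebra of the free monoid on 'I_3; the index
   i : 'I_3 stands for the generator I_(i+1). *)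
Definition free3 : Type := {malg C[{fmonom 'I_3}]}.
HB.instance Definition _ := GRing.Lalgebra.on free3.

Lemma free3_scaleAr (c : C) (x y : free3) : c *: (x * y) = x * (c *: y).
Proof.
have cC (z : {malg C[{fmonom 'I_3}]}) : z * c%:MP = c%:MP * z.
  rewrite mul_malgC malgM_def fgmulgU malgZ_def.
  by apply: eq_bigr => k _; rewrite mulm1 mulrC.
rewrite -[LHS](@mul_malgC {fmonom 'I_3} C c) mulrA.
rewrite -[X in X * y]cC -mulrA; congr (x * _).
exact: mul_malgC.
Qed.
HB.instance Definition _ := GRing.Lalgebra_isAlgebra.Build C free3 free3_scaleAr.

Definition fgen (i : 'I_3) : free3 := (<< fmu i >> : {malg C[{fmonom 'I_3}]}).

Section Eval.
Variables (A : algType C) (a : 'I_3 -> A).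

Definition fmon_eval (m : {fmonom 'I_3}) : A := \prod_(i <- (m : seq _)) a i.

Lemma fmon_eval_mmorphism : mmorphism fmon_eval.
Proof.
split=> [m n|]; rewrite /fmon_eval.
  by rewrite fmM big_cat.
by rewrite fm1 big_nil.
Qed.
HB.instance Definition _ :=
  monalg.isMultiplicative.Build {fmonom 'I_3} A fmon_eval fmon_eval_mmorphism.

Definition free_eval_fun : free3 -> A := mmap (in_alg A) fmon_eval.

Lemma free_eval_zmod : zmod_morphism free_eval_fun.
Proof. exact: mmap_is_additive. Qed.
HB.instance Definition _ :=
  GRing.isZmodMorphism.Build free3 A free_eval_fun free_eval_zmod.

Lemma free_eval_monoid : monoid_morphism free_eval_fun.
Proof.
have [hM h1] : multiplicative (mmap (in_alg A) fmon_eval); last by split.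
apply: commr_mmap_is_multiplicative => g m m'.
by rewrite /GRing.comm mulr_algr mulr_algl.
Qed.
HB.instance Definition _ :=
  GRing.isMonoidMorphism.Build free3 A free_eval_fun free_eval_monoid.

Lemma free_evalZ : scalable free_eval_fun.
Proof. by move=> c x; rewrite /free_eval_fun mmapZ mulr_algl. Qed.
HB.instance Definition _ :=
  GRing.isScalable.Build C free3 A *:%R free_eval_fun free_evalZ.

Definition free_eval : {lrmorphism free3 -> A} := free_eval_fun.

Lemma free_eval_gen i : free_eval (fgen i) = a i.
Proof.
by rewrite /= /free_eval_fun mmapU /= scale1r mul1r /fmon_eval /= fmuE big_seq1.
Qed.

End Eval.
End FreeAlgebra.

Section Representations.
Variables (C : fieldType) (A : algType C).

Definition irreducible n (rho : {lrmorphism A -> 'M[C]_n}) : Prop :=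
  (0 < n)%N /\
  forall W : {vspace 'cV[C]_n},
    (forall (u : A) (v : 'cV[C]_n), v \in W -> rho u *m v \in W) ->
    W = 0%VS \/ W = fullv.

Definition equivalent m n
    (rho : {lrmorphism A -> 'M[C]_m}) (sigma : {lrmorphism A -> 'M[C]_n}) : Prop :=
  exists2 T : {linear 'cV[C]_m -> 'cV[C]_n}, bijective T
    & forall (u : A) (v : 'cV[C]_m), T (rho u *m v) = sigma u *m T v.

End Representations.

Lemma lrmorph_qcomm (C : fieldType) (F A : algType C)
    (f : {lrmorphism F -> A}) (h : C) (x y z : F) :
  f (h *: (x * y) - h^-1 *: (y * x) - z)
  = h *: (f x * f y) - h^-1 *: (f y * f x) - f z.
Proof. by rewrite !rmorphB /= !linearZ /= !rmorphM. Qed.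

Section Uq.
(* [h] is the fixed square root of q. *)
Variables (C : fieldType) (h : C).

Let x1 : free3 C := fgen C (inord 0).
Let x2 : free3 C := fgen C (inord 1).
Let x3 : free3 C := fgen C (inord 2).

Definition uq_relators : seq (free3 C) :=
  [:: h *: (x1 * x2) - h^-1 *: (x2 * x1) - x3;
      h *: (x2 * x3) - h^-1 *: (x3 * x2) - x1;
      h *: (x3 * x1) - h^-1 *: (x1 * x3) - x2].

Let eval_relators (A : algType C) (a : 'I_3 -> A) :
  h *: (a (inord 0) * a (inord 1)) - h^-1 *: (a (inord 1) * a (inord 0))
    = a (inord 2) ->
  h *: (a (inord 1) * a (inord 2)) - h^-1 *: (a (inord 2) * a (inord 1))
    = a (inord 0) ->
  h *: (a (inord 2) * a (inord 0)) - h^-1 *: (a (inord 0) * a (inord 2))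
    = a (inord 1) ->
  {in uq_relators, forall r, free_eval a r = 0}.
Proof.
move=> r1 r2 r3 r; rewrite /uq_relators 2!in_cons mem_seq1.
by move=> /or3P[] /eqP->; apply: etrans (lrmorph_qcomm _ _ _ _ _) _;
  rewrite !free_eval_gen (r1, r2, r3) subrr.
Qed.

Lemma uq_relators_proper : 1 \notin span_ideal uq_relators.
Proof.
have a0 : {in uq_relators, forall r, free_eval (fun=> 0 : 'M[C]_1) r = 0}.
  by apply: eval_relators; rewrite mul0r !scaler0 subrr.
apply/negP => /(span_ideal_ker a0)/eqP.
by rewrite rmorph1 oner_eq0.
Qed.

Definition Uq_so3 : Type := alg_quot uq_relators_proper.
HB.instance Definition _ := GRing.Algebra.on Uq_so3.

Definition uI1 : Uq_so3 := alg_pi uq_relators_proper x1.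
Definition uI2 : Uq_so3 := alg_pi uq_relators_proper x2.
Definition uI3 : Uq_so3 := alg_pi uq_relators_proper x3.

Lemma uI_relations :
  [/\ h *: (uI1 * uI2) - h^-1 *: (uI2 * uI1) = uI3,
      h *: (uI2 * uI3) - h^-1 *: (uI3 * uI2) = uI1
    & h *: (uI3 * uI1) - h^-1 *: (uI1 * uI3) = uI2].
Proof.
have E x y z : h *: (x * y) - h^-1 *: (y * x) - z \in uq_relators ->
  h *: (alg_pi uq_relators_proper x * alg_pi uq_relators_proper y)
  - h^-1 *: (alg_pi uq_relators_proper y * alg_pi uq_relators_proper x)
  = alg_pi uq_relators_proper z.
  move=> /(alg_pi_rel uq_relators_proper) E; apply/eqP; rewrite -subr_eq0.
  by apply/eqP; apply: etrans E; apply/esym; apply: (lrmorph_qcomm (alg_pi _)).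
split; apply: E; rewrite /uq_relators.
- exact: mem_head.
- by rewrite in_cons mem_head orbT.
- by rewrite in_cons orbC in_cons mem_head orbT.
Qed.

Section Lift.
Variables (A : algType C) (a1 a2 a3 : A).
Hypothesis r1 : h *: (a1 * a2) - h^-1 *: (a2 * a1) = a3.
Hypothesis r2 : h *: (a2 * a3) - h^-1 *: (a3 * a2) = a1.
Hypothesis r3 : h *: (a3 * a1) - h^-1 *: (a1 * a3) = a2.

Let a (i : 'I_3) : A := [:: a1; a2; a3]`_i.

Let a_rel : {in uq_relators, forall r, free_eval a r = 0}.
Proof. by apply: eval_relators; rewrite /a !inordK. Qed.

Definition uq_lift : {lrmorphism Uq_so3 -> A} :=
  quot_lift uq_relators_proper a_rel.

Lemma uq_liftE : [/\ uq_lift uI1 = a1, uq_lift uI2 = a2 & uq_lift uI3 = a3].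
Proof.
by split; apply: etrans (quot_lift_pi _ _ _) _; rewrite free_eval_gen /a inordK.
Qed.

End Lift.
End Uq.

(* Sufficient conditions for X, Y and q^{1/2} XY - q^{-1/2} YX to satisfy the
   relations of U_q(so_3), for X diagonal and Y tridiagonal. *)
Section Tridiagonal.
Variables (C : fieldType) (N : nat) (h g : C) (x a b c : nat -> C).
Variables X Y : 'M[C]_N.

Definition stdcol (k : nat) : 'cV[C]_N := \col_(i < N) (i == k :> nat)%:R.
Local Notation e := stdcol.

Lemma stdcol_out k : (N <= k)%N -> e k = 0.
Proof.
move=> Nk; apply/matrixP => i j; rewrite !mxE.
by rewrite ltn_eqF // (leq_trans (ltn_ord i)).
Qed.

Lemma stdcol_eq (A B : 'M[C]_N) :
  (forall k, (k < N)%N -> A *m e k = B *m e k) -> A = B.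
Proof.
have colE (M : 'M[C]_N) (k : 'I_N) i : (M *m e k) i 0 = M i k.
  rewrite mxE (bigD1 k) //= mxE eqxx mulr1 big1 ?addr0 // => j jk.
  by rewrite mxE -[(j == k :> nat)]/(j == k) (negPf jk) mulr0.
by move=> H; apply/matrixP => i k; rewrite -!colE H.
Qed.

Hypothesis HX : forall k, (k < N)%N -> X *m e k = x k *: e k.
Hypothesis HY : forall k, (k < N)%N ->
  Y *m e k = a k *: e k.+1 + b k *: e k.-1 + c k *: e k.
Hypothesis aN : a N.-1 = 0.
Hypothesis b0 : b 0%N = 0.
Hypothesis cS : forall k, c k.+1 = 0.

Let zp k := h * x k.+1 - g * x k.
Let zm k := h * x k - g * x k.+1.
Let zc := (h - g) * x 0%N.
Hypothesis H1 : forall k, zp k * zm k = 1.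
Hypothesis H1' : c 0%N * (zc * zc) = c 0%N.
Hypothesis H2 : forall k, h * zp k = g * zp k.+1.
Hypothesis H2' : forall k, h * zm k.+1 = g * zm k.
Hypothesis H3 : c 0%N * (h * zc - g * zp 0) = 0.
Hypothesis H3' : c 0%N * (h * zm 0 - g * zc) = 0.
Hypothesis H40 : a 0%N * b 1%N * (h * zp 0 - g * zm 0)
  + c 0%N * c 0%N * ((h - g) * zc) = x 0%N.
Hypothesis H4S : forall k, a k.+1 * b k.+2 * (h * zp k.+1 - g * zm k.+1)
  + a k * b k.+1 * (h * zm k - g * zp k) = x k.+1.

Let HXa k : X *m e k = x k *: e k.
Proof.
have [/HX //|Nk] := ltnP k N; by rewrite stdcol_out // mulmx0 scaler0.
Qed.

Let ltNa k : (k < N)%N -> a k <> 0 -> (k.+1 < N)%N.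
Proof.
move=> kN ak; case: (ltngtP k.+1 N) => // [|E]; first by rewrite ltnS leqNgt kN.
by case: ak; rewrite -aN -E.
Qed.

Let aHY k : (k < N)%N -> a k *: (Y *m e k.+1) =
  a k *: (a k.+1 *: e k.+2 + b k.+1 *: e k).
Proof.
move=> kN; have [->|/eqP ak] := eqVneq (a k) 0; first by rewrite !scale0r.
by rewrite HY ?ltNa // cS scale0r addr0.
Qed.

Let Z := h *: (X *m Y) - g *: (Y *m X).

Let HZ k : (k < N)%N -> Z *m e k =
  (a k * zp k) *: e k.+1 + (b k * (h * x k.-1 - g * x k)) *: e k.-1
  + (c k * ((h - g) * x k)) *: e k.
Proof.
move=> kN; rewrite /Z mulmxBl -!scalemxAl -!mulmxA HXa -scalemxAr HY //.
rewrite !mulmxDr -!scalemxAr !HXa.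
apply/matrixP => i j; rewrite /zp !mxE.
move: (i == k.+1 :> nat)%:R (i == k.-1 :> nat)%:R (i == k :> nat)%:R => d1 d2 d3; ring.
Qed.

Let aHZ k : (k < N)%N -> a k *: (Z *m e k.+1) =
  a k *: ((a k.+1 * zp k.+1) *: e k.+2 + (b k.+1 * zm k) *: e k).
Proof.
move=> kN; have [->|/eqP ak] := eqVneq (a k) 0; first by rewrite !scale0r.
by rewrite HZ ?ltNa // cS mul0r scale0r addr0.
Qed.

Lemma tri_rel3 : h *: (Z *m X) - g *: (X *m Z) = Y.
Proof.
apply: stdcol_eq => k kN.
rewrite mulmxBl -!scalemxAl -!mulmxA HXa -!scalemxAr HZ // HY //.
rewrite !mulmxDr -!scalemxAr !HXa.
apply/matrixP => i j; rewrite !mxE.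
case: k kN => [|k] kN.
  move: H1' (H1 0); rewrite /zc /zp /zm b0 /= => E1 E2.
  move: (i == 0%N :> nat)%:R (i == 1%N :> nat)%:R => d0 d1.
  transitivity (a 0%N * ((h * x 1 - g * x 0) * (h * x 0 - g * x 1)) * d1
    + (c 0%N * ((h - g) * x 0 * ((h - g) * x 0))) * d0); first by ring.
  by rewrite E1 E2; ring.
move: (H1 k) (H1 k.+1); rewrite /zp /zm cS /= => E1 E2.
move: (i == k.+2 :> nat)%:R (i == k :> nat)%:R (i == k.+1 :> nat)%:R => d0 d1 d2.
transitivity (a k.+1 *
   ((h * x k.+2 - g * x k.+1) * (h * x k.+1 - g * x k.+2)) * d0
    + b k.+1 * ((h * x k.+1 - g * x k) * (h * x k - g * x k.+1)) * d1);
  first by ring.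
by rewrite E1 E2; ring.
Qed.

Lemma tri_rel2 : h *: (Y *m Z) - g *: (Z *m Y) = X.
Proof.
apply: stdcol_eq => k kN.
rewrite mulmxBl -!scalemxAl -!mulmxA HXa HZ // HY //.
rewrite !mulmxDr -!scalemxAr.
rewrite [a k * zp k]mulrC -[(zp k * a k) *: _]scalerA aHY // aHZ //.
case: k kN => [|[|k]] kN /=.
- rewrite b0 mul0r !scale0r !addr0 HY // HZ // b0 /=.
  apply/matrixP => i j; rewrite !mxE.
  have E2 : h * zp 0 - g * zp 1 = 0 by rewrite H2 subrr.
  move: H3 H40; rewrite -/zc => E3 E4.
  move: (i == 0%N :> nat)%:R (i == 1%N :> nat)%:R (i == 2%N :> nat)%:R => d0 d1 d2.
  transitivity (a 0%N * a 1%N * (h * zp 0 - g * zp 1) * d2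
    + a 0%N * (c 0%N * (h * zc - g * zp 0)) * d1
    + (a 0%N * b 1%N * (h * zp 0 - g * zm 0)
       + c 0%N * c 0%N * ((h - g) * zc)) * d0); first by rewrite /zc; ring.
  by rewrite E2 E3 E4; ring.
- rewrite cS mul0r !scale0r !addr0 -/(zm 0) (HY (ltnW kN)) (HZ (ltnW kN)) b0 /=.
  apply/matrixP => i j; rewrite !mxE.
  have E2 : h * zp 1 - g * zp 2 = 0 by rewrite H2 subrr.
  move: H3' (H4S 0); rewrite -/zc => E3 E4.
  move: (i == 0%N :> nat)%:R (i == 1%N :> nat)%:R (i == 3%N :> nat)%:R
    => d0 d1 d3.
  transitivity (a 1%N * a 2%N * (h * zp 1 - g * zp 2) * d3
    + b 1%N * (c 0%N * (h * zm 0 - g * zc)) * d0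
    + (a 1%N * b 2%N * (h * zp 1 - g * zm 1)
       + a 0%N * b 1%N * (h * zm 0 - g * zp 0)) * d1); first by ring.
  by rewrite E2 E3 E4; ring.
rewrite cS mul0r !scale0r !addr0 -/(zm k.+1) (HY (ltnW kN)) (HZ (ltnW kN)) cS /=.
rewrite -/(zm k).
apply/matrixP => i j; rewrite !mxE.
have E2 : h * zp k.+2 - g * zp k.+3 = 0 by rewrite H2 subrr.
have E3 : h * zm k.+1 - g * zm k = 0 by rewrite H2' subrr.
have E4 := H4S k.+1.
move: (i == k :> nat)%:R (i == k.+2 :> nat)%:R (i == k.+4 :> nat)%:R => d0 d2 d4.
transitivity (a k.+2 * a k.+3 * (h * zp k.+2 - g * zp k.+3) * d4
    + b k.+2 * b k.+1 * (h * zm k.+1 - g * zm k) * d0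
    + (a k.+2 * b k.+3 * (h * zp k.+2 - g * zm k.+2)
       + a k.+1 * b k.+2 * (h * zm k.+1 - g * zp k.+1)) * d2); first by ring.
by rewrite E2 E3 E4; ring.
Qed.

End Tridiagonal.

Section QRepresentations.
Variables (C : numClosedFieldType) (q h : C).

(* q^a for a half-integer [a], where q^{1/2} is [h]; the value is junk when
   2a is not an integer. *)
Definition qpow (a : rat) : C := h ^ numq (2%:R * a).

Definition qnum (a : rat) : C := (qpow a - qpow (- a)) / (q - q^-1).

(* The operator whose value on the i-th basis vector is [f i]. *)
Definition op_of n (f : 'I_n -> 'cV[C]_n) : 'M[C]_n := \matrix_(j, i) f i j 0.

(* The vector |k> for k = 1, ..., n, and 0 for other values of k. *)
Definition ket n (k : nat) : 'cV[C]_n := \col_(i < n) (i.+1 == k)%:R.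

Definition nc_I1 n (k : nat) : 'cV[C]_n :=
  (- ((qpow (k%:R - 1 / 2%:R) + qpow (- k%:R + 1 / 2%:R)) / (q - q^-1)))
    *: ket n k.

Definition nc_I2 (s : bool) n (k : nat) : 'cV[C]_n :=
  if k == 1%N then
    ((-1) ^+ s * (qnum n%:R / (qpow (1 / 2%:R) - qpow (- (1 / 2%:R)))))
      *: ket n 1
    + ('i * (qnum (n%:R - 1) / (qpow (1 / 2%:R) - qpow (- (1 / 2%:R)))))
      *: ket n 2
  else
    ('i * (qnum (n%:R - k%:R)
           / (qpow (k%:R - 1 / 2%:R) - qpow (- k%:R + 1 / 2%:R))))
      *: ket n k.+1
    + ('i * (qnum (n%:R + k%:R - 1)
             / (qpow (k%:R - 1 / 2%:R) - qpow (- k%:R + 1 / 2%:R))))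
      *: ket n k.-1.

(* The images of I_1 and I_2 under R_n; the booleans [e] and [s] are the signs
   of the first and second superscript, [false] standing for plus. *)
Definition nc_op1 (e : bool) n : 'M[C]_n :=
  (-1) ^+ e *: op_of (fun i : 'I_n => nc_I1 n i.+1).
Definition nc_op2 (e s : bool) n : 'M[C]_n :=
  (-1) ^+ e *: op_of (fun i : 'I_n => nc_I2 s n i.+1).

(* l = d / 2, so that d ranges over nat when l ranges over 0, 1/2, 1, 3/2, ... *)
Definition spin (d : nat) : rat := d%:R / 2%:R.

(* The vector |m> for m = -l, -l+1, ..., l, and 0 for other values of m. *)
Definition cket d (m : rat) : 'cV[C]_d.+1 :=
  \col_(i < d.+1) (m == - spin d + i%:R)%:R.

Definition cl_I1 d (m : rat) : 'cV[C]_d.+1 := ('i * qnum m) *: cket d m.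

Definition cl_I2 d (m : rat) : 'cV[C]_d.+1 :=
  (qpow m + qpow (- m))^-1 *:
    (qnum (spin d - m) *: cket d (m + 1) - qnum (spin d + m) *: cket d (m - 1)).

Definition cl_op1 d : 'M[C]_d.+1 :=
  op_of (fun i : 'I_d.+1 => cl_I1 d (- spin d + i%:R)).
Definition cl_op2 d : 'M[C]_d.+1 :=
  op_of (fun i : 'I_d.+1 => cl_I2 d (- spin d + i%:R)).

Hypothesis hE : h ^+ 2 = q.
Hypothesis q_neq0 : q != 0.
Hypothesis q_nru : forall n, (0 < n)%N -> ~~ n.-unity_root q.

Lemma h_neq0 : h != 0.
Proof. by move: q_neq0; rewrite -hE expf_eq0. Qed.

Lemma q_exp_neq1 n : (0 < n)%N -> q ^+ n - 1 != 0.
Proof. by move=> /q_nru; rewrite unity_rootE -subr_eq0. Qed.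

Lemma qpowN a : qpow (- a) = (qpow a)^-1.
Proof. by rewrite /qpow mulrN numqN -invr_expz. Qed.

Lemma qpow_half (z : int) a : 2%:R * a = z%:~R -> qpow a = h ^ z.
Proof. by rewrite /qpow => ->; rewrite numq_int. Qed.

Lemma qpow_nat n : qpow n%:R = q ^+ n.
Proof.
rewrite (@qpow_half (n * 2)%N); first by rewrite -exprnP mulnC exprM hE.
by rewrite -[RHS]/((n * 2)%:R) natrM mulrC.
Qed.

Lemma qpow_1half : qpow (1 / 2%:R) = h.
Proof. by rewrite (@qpow_half 1) // mulrC divfK. Qed.

Lemma qpowD a b : 2%:R * a \is a Num.int -> 2%:R * b \is a Num.int ->
  qpow (a + b) = qpow a * qpow b.
Proof.
move=> /intrP[x xE] /intrP[y yE].
rewrite (qpow_half xE) (qpow_half yE) -expfzDr ?h_neq0 //.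
by apply: qpow_half; rewrite mulrDr xE yE intrD.
Qed.

Lemma half_nat n : 2%:R * n%:R \is a @Num.int rat.
Proof. by rewrite -natrM. Qed.
Lemma half_half n : 2%:R * (n%:R / 2%:R) \is a @Num.int rat.
Proof. by rewrite mulrC divfK. Qed.
Lemma half_opp (a : rat) : 2%:R * a \is a Num.int -> 2%:R * - a \is a Num.int.
Proof. by rewrite mulrN rpredN. Qed.
Lemma half_add (a b : rat) : 2%:R * a \is a Num.int -> 2%:R * b \is a Num.int ->
  2%:R * (a + b) \is a Num.int.
Proof. by rewrite mulrDr => ? ?; apply: rpredD. Qed.

Lemma op_of_stdcol n (f : 'I_n -> 'cV[C]_n) (k : 'I_n) :
  op_of f *m stdcol C n k = f k.
Proof.
apply/matrixP => i j; rewrite ord1 mxE (bigD1 k) //= !mxE eqxx mulr1.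
rewrite big1 ?addr0 // => l lk.
by rewrite !mxE -[(l == k :> nat)]/(l == k) (negPf lk) mulr0.
Qed.

Lemma ket_stdcol n k : ket n k.+1 = stdcol C n k.
Proof. by apply/matrixP => i j; rewrite !mxE eqSS. Qed.

Lemma cket_stdcol d k : cket d (- spin d + k%:R) = stdcol C d.+1 k.
Proof.
apply/matrixP => i j; rewrite !mxE (inj_eq (addrI _)) eqr_nat.
by rewrite eq_sym.
Qed.

Let g := h^-1.

Section NonclassicalRelations.
Variables (n : nat) (s : bool).
Local Notation N := n.+1.
Let X : 'M[C]_N := op_of (fun i : 'I_N => nc_I1 N i.+1).
Let Y : 'M[C]_N := op_of (fun i : 'I_N => nc_I2 s N i.+1).

Let u k := q ^+ k.
Let D := q - q^-1.
Let E k := h * u k - (h * u k)^-1.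
Let xx k := - ((h * u k + (h * u k)^-1) / D).
Let aa k := ((u N / u k.+1) - (u N / u k.+1)^-1) / D / E k.
Let bb k := if k is k'.+1 then ((u N * u k) - (u N * u k)^-1) / D / E k else 0.
Let cc k := if k is 0%N then (-1) ^+ s * ((u N - (u N)^-1) / D / (h - h^-1)) else 0.

Let hn0 := h_neq0.
Let un0 k : u k != 0.
Proof. by rewrite expf_neq0. Qed.
Let uS k : u k.+1 = h ^+ 2 * u k.
Proof. by rewrite /u exprS hE. Qed.

Let qp1 k : qpow (k.+1%:R - 1 / 2%:R) = h * u k.
Proof.
rewrite qpowD ?half_nat ?half_opp ?half_half //.
by rewrite qpow_nat qpowN qpow_1half -/(u k.+1) uS expr2; field.
Qed.
Let qp2 k : qpow (- k.+1%:R + 1 / 2%:R) = (h * u k)^-1.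
Proof. by rewrite -[- _ + _]opprK opprD opprK qpowN qp1. Qed.
Let qn1 k : qnum (N%:R - k.+1%:R) = (u N / u k.+1 - (u N / u k.+1)^-1) / D.
Proof.
by rewrite /qnum qpowN qpowD ?half_opp ?half_nat // qpowN !qpow_nat.
Qed.
Let qn2 k : qnum (N%:R + k.+1%:R - 1) = (u N * u k - (u N * u k)^-1) / D.
Proof.
have -> : N%:R + k.+1%:R - 1 = (N + k)%:R :> rat.
  by rewrite -addrA -[k.+1%:R]natr1 addrK natrD.
by rewrite /qnum qpowN qpow_nat exprD.
Qed.

Let XE k : (k < N)%N -> X *m stdcol C N k = xx k *: stdcol C N k.
Proof.
move=> kN; rewrite (op_of_stdcol _ (Ordinal kN)) /nc_I1 ket_stdcol.
by rewrite qp1 qp2.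
Qed.

Let YE k : (k < N)%N -> Y *m stdcol C N k =
  ('i * aa k) *: stdcol C N k.+1 + ('i * bb k) *: stdcol C N k.-1
  + cc k *: stdcol C N k.
Proof.
move=> kN; rewrite (op_of_stdcol _ (Ordinal kN)) /nc_I2 /=.
case: k kN => [|k] kN /=.
  rewrite !ket_stdcol qpowN qpow_1half (qn1 0) mulr0 scale0r addr0 addrC /aa.
  have -> : E 0 = h - h^-1 by rewrite /E /u expr0 mulr1.
  by rewrite /qnum qpowN qpow_nat.
by rewrite !ket_stdcol qp1 qp2 qn1 qn2 scale0r addr0.
Qed.

Let Dn0 : D != 0.
Proof.
have := q_exp_neq1 (isT : 0 < 2)%N; apply: contraNneq => D0.
have -> : q ^+ 2 - 1 = D * q by rewrite /D; field.
by rewrite D0 mul0r.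
Qed.
Let En0 k : E k != 0.
Proof.
have := q_exp_neq1 (isT : 0 < k.*2.+1)%N; apply: contraNneq => E0.
have -> : q ^+ k.*2.+1 - 1 = E k * (h * u k).
  rewrite /E -addnn exprS exprD -/(u k) -hE; field.
  by rewrite hn0 un0.
by rewrite E0 mul0r.
Qed.

Let side4 : (h * h) ^+ 2 - 1 != 0.
Proof. by rewrite -expr2 hE; apply: q_exp_neq1. Qed.
Let sideN k : h * u k * (h * u k) - 1 != 0.
Proof.
have -> : h * u k * (h * u k) - 1 = E k * (h * u k).
  by rewrite /E; field; rewrite hn0 un0.
by rewrite !mulf_neq0.
Qed.

Let DE : D = h ^+ 2 - (h ^+ 2)^-1.
Proof. by rewrite /D hE. Qed.

Let ii (a b : C) : 'i * a * ('i * b) = - (a * b).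
Proof. by rewrite mulrACA -expr2 sqrCi mulN1r. Qed.

Let zp k := h * xx k.+1 - g * xx k.
Let zm k := h * xx k - g * xx k.+1.
Let zc := (h - g) * xx 0%N.

Let sgn2 (y z : C) : ((-1) ^+ s * y) * ((-1) ^+ s * z) = y * z.
Proof. by rewrite mulrACA -expr2 sqrr_sign mul1r. Qed.

Let H1 k : zp k * zm k = 1.
Proof.
rewrite /zp /zm /xx /g DE uS; field; rewrite ?hn0 ?side4 ?un0 //.
Qed.

Let zc1 : zc * zc = 1.
Proof.
rewrite /zc /xx /g DE /u expr0; field; rewrite ?hn0 ?side4 ?un0 //.
Qed.

Let H2 k : h * zp k = g * zp k.+1.
Proof.
rewrite /zp /zm /xx /g DE !uS; field; rewrite ?hn0 ?side4 ?un0 //.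
Qed.

Let H2' k : h * zm k.+1 = g * zm k.
Proof.
rewrite /zp /zm /xx /g DE !uS; field; rewrite ?hn0 ?side4 ?un0 //.
Qed.

Let H3 : h * zc - g * zp 0 = 0.
Proof.
rewrite /zc /zp /zm /xx /g DE !uS /u expr0; field; rewrite ?hn0 ?side4 ?un0 //.
Qed.

Let H3' : h * zm 0 - g * zc = 0.
Proof.
rewrite /zc /zp /zm /xx /g DE !uS /u expr0; field; rewrite ?hn0 ?side4 ?un0 //.
Qed.

Let H40 : - (aa 0%N * bb 1%N) * (h * zp 0 - g * zm 0)
  + ((u N - (u N)^-1) / D / (h - h^-1)) * ((u N - (u N)^-1) / D / (h - h^-1))
    * ((h - g) * zc) = xx 0%N.
Proof.
have a0 := sideN 0; have a1 := sideN 1; rewrite !uS in a1.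
rewrite /aa /bb /E /zc /zp /zm /xx /g DE !uS.
have u0 : u 0 = 1 by [].
rewrite u0 ?mulr1 in a0 a1 *.
field.
by rewrite hn0 side4 un0 a0 a1.
Qed.

Let H4S k : - (aa k.+1 * bb k.+2) * (h * zp k.+1 - g * zm k.+1)
  - (aa k * bb k.+1) * (h * zm k - g * zp k) = xx k.+1.
Proof.
have a1 := sideN k.+1; have a2 := sideN k.+2; rewrite !uS in a1 a2.
rewrite /aa /bb /E /zc /zp /zm /xx /g DE !uS.
field.
by rewrite hn0 side4 !un0 a1 a2 sideN.
Qed.

Lemma nc_relations (Z := h *: (X *m Y) - h^-1 *: (Y *m X)) :
  h *: (Y *m Z) - h^-1 *: (Z *m Y) = X /\ h *: (Z *m X) - h^-1 *: (X *m Z) = Y.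
Proof.
have aN : 'i * aa N.-1 = 0.
  by rewrite /aa divff // invr1 subrr !mul0r mulr0.
split.
- apply: (tri_rel2 XE YE); rewrite -/(zp _) //.
  + by rewrite mulr0.
  + by rewrite H3 mulr0.
  + by rewrite H3' mulr0.
  + by rewrite ii sgn2; exact: H40.
  + by move=> k; rewrite !ii [X in _ + X]mulNr; exact: H4S.
- apply: (tri_rel3 XE YE) => //; first by rewrite mulr0.
  by rewrite -/zc zc1 mulr1.
Qed.

End NonclassicalRelations.

Section ClassicalRelations.
Variable d : nat.
Local Notation N := d.+1.

Let u k := q ^+ k.
Let v := h ^+ d.
Let D := q - q^-1.
Let mm k := (u k / v - (u k / v)^-1) / D.
Let S k := u k / v + (u k / v)^-1.
Let aa k := (v * v / u k - (v * v / u k)^-1) / D / S k.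
Let bb k := - ((u k - (u k)^-1) / D / S k).

Let hn0 := h_neq0.
Let un0 k : u k != 0.
Proof. by rewrite expf_neq0. Qed.
Let vn0 : v != 0.
Proof. by rewrite expf_neq0. Qed.
Let uS k : u k.+1 = h ^+ 2 * u k.
Proof. by rewrite /u exprS hE. Qed.

Let half_spin : 2%:R * spin d \is a Num.int.
Proof. exact: half_half. Qed.
Let qp_spin : qpow (spin d) = v.
Proof. by rewrite (@qpow_half d) // mulrC divfK. Qed.
Let qpm k : qpow (- spin d + k%:R) = u k / v.
Proof.
by rewrite qpowD ?half_opp ?half_nat // qpowN qp_spin qpow_nat mulrC.
Qed.
Let qnm k : qnum (- spin d + k%:R) = mm k.
Proof. by rewrite /qnum qpowN qpm. Qed.
Let qn1 k : qnum (spin d - (- spin d + k%:R)) =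
  (v * v / u k - (v * v / u k)^-1) / D.
Proof.
rewrite /qnum qpowN; have -> // : qpow (spin d - (- spin d + k%:R)) = v * v / u k.
rewrite qpowD ?half_opp ?half_add ?half_opp ?half_nat // qpowN qpm qp_spin.
by rewrite invf_div mulrA.
Qed.
Let qn2 k : qnum (spin d + (- spin d + k%:R)) = (u k - (u k)^-1) / D.
Proof. by rewrite addNKr /qnum qpowN qpow_nat. Qed.

Let XE k : (k < N)%N -> cl_op1 d *m stdcol C N k = ('i * mm k) *: stdcol C N k.
Proof.
move=> kN; rewrite (op_of_stdcol _ (Ordinal kN)) /cl_I1 /=.
by rewrite cket_stdcol qnm.
Qed.

Let YE k : (k < N)%N -> cl_op2 d *m stdcol C N k =
  aa k *: stdcol C N k.+1 + bb k *: stdcol C N k.-1 + 0 *: stdcol C N k.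
Proof.
move=> kN; rewrite (op_of_stdcol _ (Ordinal kN)) /cl_I2 /=.
rewrite qpowN qpm qn1 qn2 -[_ + k%:R + 1]addrA natr1 cket_stdcol -/(S k).
rewrite scale0r addr0 scalerBr !scalerA -scaleNr !(mulrC (S k)^-1).
congr (_ + _); case: k kN => [|k] kN.
  by rewrite /bb /u expr0 invr1 subrr !mul0r oppr0 !scale0r.
by rewrite -[_ + k.+1%:R - 1]addrA -[k.+1%:R]natr1 addrK cket_stdcol.
Qed.

Let side4 : (h * h) ^+ 2 - 1 != 0.
Proof. by rewrite -expr2 hE; apply: q_exp_neq1. Qed.

Let sideN k : u k * u k + v * v != 0.
Proof.
apply/eqP => uv; have uv2 : u k * u k = - (v * v) by apply/eqP; rewrite -addr_eq0 uv.
have : q ^+ (k * 4) = q ^+ (d * 2).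
  transitivity ((u k * u k) * (u k * u k)).
    by rewrite exprM -/(u k); ring.
  by rewrite uv2 mulrNN /v -hE -exprM -!exprD !addnn -!muln2 [in RHS]mulnC.
have qinj i j : (i <= j)%N -> q ^+ i = q ^+ j -> i = j.
  move=> ij /eqP; rewrite -(subnK ij) exprD -subr_eq0 -opprB oppr_eq0.
  rewrite -[X in _ - X]mul1r -mulrBl mulf_eq0 expf_eq0 (negPf q_neq0) andbF orbF.
  by case: (j - i)%N => [|l] //; rewrite (negPf (q_exp_neq1 _)).
move=> E; have {}E : (k * 4 = d * 2)%N.
  have [/qinj/(_ E)//|/ltnW/qinj/(_ (esym E))//] := leqP (k * 4) (d * 2).
have vu : v = u k.
  have dk : d = (2 * k)%N.
    by apply/eqP; rewrite -(eqn_pmul2r (isT : 0 < 2)%N) -E mulnAC mulnC.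
  by rewrite /v dk exprM hE.
move/eqP: uv; rewrite vu -mulr2n mulrn_eq0 /= mulf_eq0 orbb.
by rewrite (negPf (un0 k)).
Qed.

Let DE : D = h ^+ 2 - (h ^+ 2)^-1.
Proof. by rewrite /D hE. Qed.

Let zp k := h * mm k.+1 - g * mm k.
Let zm k := h * mm k - g * mm k.+1.

Let H1 k : zp k * zm k = - 1.
Proof.
rewrite /zp /zm /mm /g DE uS; field; rewrite ?hn0 ?side4 ?un0 ?vn0 //.
Qed.

Let H2 k : h * zp k = g * zp k.+1.
Proof.
rewrite /zp /zm /mm /g DE !uS; field; rewrite ?hn0 ?side4 ?un0 ?vn0 //.
Qed.

Let H2' k : h * zm k.+1 = g * zm k.
Proof.
rewrite /zp /zm /mm /g DE !uS; field; rewrite ?hn0 ?side4 ?un0 ?vn0 //.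
Qed.

Let H40 : (aa 0%N * bb 1%N) * (h * zp 0 - g * zm 0) = mm 0%N.
Proof.
have a0 := sideN 0; have a1 := sideN 1; rewrite !uS in a1.
rewrite /aa /bb /S /mm /zp /zm /mm /g DE !uS.
have u0 : u 0 = 1 by [].
rewrite u0 ?mulr1 in a0 a1 *.
field; rewrite ?hn0 ?side4 ?un0 ?vn0 ?a0 ?a1 //.
Qed.

Let H4S k : (aa k.+1 * bb k.+2) * (h * zp k.+1 - g * zm k.+1)
  + (aa k * bb k.+1) * (h * zm k - g * zp k) = mm k.+1.
Proof.
have a0 := sideN k; have a1 := sideN k.+1; have a2 := sideN k.+2.
rewrite !uS in a0 a1 a2.
rewrite /aa /bb /S /mm /zp /zm /mm /g DE !uS.
field; rewrite ?hn0 ?side4 ?un0 ?vn0 ?a0 ?a1 ?a2 //.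
Qed.

Let factor_i k l (y z : C) : y * ('i * mm k) - z * ('i * mm l) =
  'i * (y * mm k - z * mm l).
Proof. by ring. Qed.
Let i2 (y z : C) : ('i * y) * ('i * z) = - (y * z).
Proof. by rewrite mulrACA -expr2 sqrCi mulN1r. Qed.
Let factor_i2 (y z t w : C) : y * ('i * t) - z * ('i * w) = 'i * (y * t - z * w).
Proof. by ring. Qed.

Lemma cl_relations (X := cl_op1 d) (Y := cl_op2 d)
    (Z := h *: (X *m Y) - h^-1 *: (Y *m X)) :
  h *: (Y *m Z) - h^-1 *: (Z *m Y) = X /\ h *: (Z *m X) - h^-1 *: (X *m Z) = Y.
Proof.
have aN : aa N.-1 = 0.
  by rewrite /aa /u -hE -exprM mulnC exprM expr2 divff ?mulf_neq0 // invr1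
    subrr !mul0r.
have b0 : bb 0%N = 0 by rewrite /bb /u expr0 invr1 subrr !mul0r oppr0.
split.
- apply: (tri_rel2 (c := fun=> 0) XE YE) => //.
  + by move=> k; rewrite !factor_i mulrCA H2 mulrCA.
  + by move=> k; rewrite !factor_i mulrCA H2' mulrCA.
  + by rewrite mul0r.
  + by rewrite mul0r.
  + by rewrite !factor_i !factor_i2 !mul0r addr0 mulrCA; congr (_ * _); exact: H40.
  + by move=> k; rewrite !factor_i !factor_i2 !(mulrCA _ 'i) -mulrDr;
      congr (_ * _); exact: H4S.
- apply: (tri_rel3 (c := fun=> 0) XE YE) => //.
  + by move=> k; rewrite !factor_i i2 H1 opprK.
  + by rewrite mul0r.
Qed.

End ClassicalRelations.

Lemma nc_op_relations (e s : bool) p (X := nc_op1 e p.+1) (Y := nc_op2 e s p.+1)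
    (Z := h *: (X * Y) - h^-1 *: (Y * X)) :
  h *: (Y * Z) - h^-1 *: (Z * Y) = X /\ h *: (Z * X) - h^-1 *: (X * Z) = Y.
Proof.
have [E1 E2] := nc_relations p s.
have tt (A B : 'M[C]_p.+1) : ((-1) ^+ e *: A) * ((-1) ^+ e *: B) = A * B.
  by rewrite -scalerAl -scalerAr scalerA -expr2 sqrr_sign scale1r.
rewrite /Z !tt /X /Y -!scalerAl -!scalerAr.
by split; rewrite !(scalerA _ ((-1) ^+ e)) !(mulrC _ ((-1) ^+ e)) -!scalerA
  -scalerBr; congr (_ *: _).
Qed.

(* The four families R_n^{(+-i,+-)}, n = p + 1, with signs [e] and [s] in this order. *)
Definition rep_nc (e s : bool) (p : nat) : {lrmorphism Uq_so3 h -> 'M[C]_p.+1} :=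
  uq_lift (erefl _) (nc_op_relations e s p).1 (nc_op_relations e s p).2.

(* R_l^{(1)} for l = d / 2. *)
Definition rep_cl (d : nat) : {lrmorphism Uq_so3 h -> 'M[C]_d.+1} :=
  uq_lift (erefl _) (cl_relations d).1 (cl_relations d).2.

Lemma rep_ncE e s p :
  rep_nc e s p (uI1 h) = nc_op1 e p.+1 /\ rep_nc e s p (uI2 h) = nc_op2 e s p.+1.
Proof.
by case: (uq_liftE (erefl _) (nc_op_relations e s p).1 (nc_op_relations e s p).2).
Qed.

Lemma rep_clE d :
  rep_cl d (uI1 h) = cl_op1 d /\ rep_cl d (uI2 h) = cl_op2 d.
Proof. by case: (uq_liftE (erefl _) (cl_relations d).1 (cl_relations d).2). Qed.

End QRepresentations.

(* Main.v *)
Require Import Defs.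
From HB Require Import structures.
From mathcomp Require Import all_boot all_order all_algebra.
From mathcomp Require Import reals complex.
From mathcomp Require Import ring.
Import Order.TTheory GRing.Theory Num.Theory.
Local Open Scope ring_scope.

(** Irreducibility comes from the shape of the two generators: I_1 is diagonal
    with pairwise distinct eigenvalues, so a subspace stable under I_1 contains
    every basis vector on which one of its elements has a nonzero coordinate,
    and I_2 is tridiagonal with nonzero entries next to the diagonal, so a
    stable subspace with one basis vector contains the neighbouring ones, hence
    all of them ([stable_tridiagonal]).  Both conditions hold because q is not
    a root of unity.

    Nonequivalence is read off from characters: equivalent representations have
    the same traces ([equivalent_trace]).  With c_n = [n] / (q^(1/2) - q^(-1/2)),
    which is nonzero, the representation with signs (-1)^e and (-1)^s has

    - trace n at 1, so the character determines n;
    - trace -(-1)^e c_n at I_1, because the eigenvalues form a geometric sum;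
    - trace (-1)^e (-1)^s c_n at I_2, because its only nonzero diagonal entry is
      the one at |1>.

    These three values determine n, e and s.  In the classical representation
    I_2 has zero diagonal, hence trace 0, which none of the numbers
    (-1)^e (-1)^s c_n equals. *)

(** * Stable subspaces of a diagonal and a tridiagonal operator *)

Section StableSubspaces.
Context {C : fieldType} {n : nat} {d : 'rV[C]_n} {W : {vspace 'cV[C]_n}}.
Hypothesis d_inj : injective (d 0).
Hypothesis W_diag : forall v, v \in W -> diag_mx d *m v \in W.

(** Applying the product of the [diag_mx d - d 0 j], for j in s, multiplies
    the coordinate at i by the product of the [d 0 i - d 0 j]: taking for s all
    indices but one isolates a coordinate. *)
Lemma stable_diag_prod (s : seq 'I_n) v : v \in W ->
  \col_i (\prod_(j <- s) (d 0 i - d 0 j) * v i 0) \in W.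
Proof.
move=> vW; elim: s => [|j s IHs].
  suff -> : \col_i (\prod_(j <- [::]) (d 0 i - d 0 j) * v i 0) = v by [].
  by apply/colP => i; rewrite mxE big_nil mul1r.
suff -> : \col_i (\prod_(k <- j :: s) (d 0 i - d 0 k) * v i 0)
  = diag_mx d *m (\col_i (\prod_(k <- s) (d 0 i - d 0 k) * v i 0))
    - d 0 j *: (\col_i (\prod_(k <- s) (d 0 i - d 0 k) * v i 0)).
  by rewrite memvB ?memvZ ?W_diag.
by apply/colP => i; rewrite mul_diag_mx !mxE big_cons mulrBl mulrBl !mulrA.
Qed.

Lemma stable_diag_delta v i : v \in W -> v i 0 != 0 -> delta_mx i 0 \in W.
Proof.
move=> /(stable_diag_prod [seq j <- index_enum 'I_n | j != i]) wW vi0.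
have wE (k : 'I_n) : \prod_(j <- [seq j <- index_enum 'I_n | j != i]) (d 0 k - d 0 j)
    = \prod_(j | j != i) (d 0 k - d 0 j) by rewrite big_filter.
set c := \prod_(j | j != i) (d 0 i - d 0 j) * v i 0.
have c0 : c != 0.
  rewrite mulf_neq0 //; apply/prodf_neq0 => j ji.
  by rewrite subr_eq0; apply: contra_neq ji => /d_inj.
suff -> : delta_mx i 0
    = c^-1 *: \col_k (\prod_(j <- [seq j <- index_enum 'I_n | j != i]) (d 0 k - d 0 j)
                      * v k 0) by apply: memvZ.
apply/colP => k; rewrite !mxE wE eqxx andbT.
have [->|ki] := eqVneq k i; first by rewrite mulVf.
by rewrite (bigD1 k) //= subrr !mul0r mulr0.
Qed.

Lemma stable_tridiagonal (Y : 'M[C]_n) :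
    (forall v, v \in W -> Y *m v \in W) ->
    (forall i j : 'I_n, i.+1 = j -> (Y i j != 0) && (Y j i != 0)) ->
  W = 0%VS \/ W = fullv.
Proof.
move=> W_Y Y0.
have [->|W0] := eqVneq W 0%VS; [by left | right].
have step i j : Y i j != 0 -> delta_mx j 0 \in W -> delta_mx i 0 \in W.
  move=> Yij jW; apply: (stable_diag_delta (Y *m delta_mx j 0)); first exact: W_Y.
  by rewrite -colE mxE.
have := memv_pick W; have : vpick W != 0 by rewrite vpick0.
move: (vpick W) => v /cV0Pn[k vk0] vW.
have kW : delta_mx k 0 \in W by apply: stable_diag_delta vW vk0.
(* Walk from k down to the index 0, then up again to any index. *)
have down m (i : 'I_n) : i = m :> nat -> delta_mx i 0 \in W ->
    forall j : 'I_n, j = 0 :> nat -> delta_mx j 0 \in W.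
  elim: m i => [|m IHm] i im iW j j0.
    by suff -> : j = i by []; apply: val_inj; rewrite /= j0 im.
  have mn : (m < n)%N by rewrite ltnW // -im.
  apply: (IHm (Ordinal mn)) => //; apply: step iW.
  by have /andP[] := Y0 (Ordinal mn) i (esym im).
have up m : forall i : 'I_n, i = m :> nat -> delta_mx i 0 \in W.
  elim: m => [|m IHm] i im; first exact: down kW i im.
  have mn : (m < n)%N by rewrite ltnW // -im.
  apply: step (IHm (Ordinal mn) erefl).
  by have /andP[] := Y0 (Ordinal mn) i (esym im).
apply/eqP; rewrite eqEsubv subvf; apply/subvP => w _.
rewrite [w]matrix_sum_delta; apply: memv_suml => i _.
by rewrite big_ord1; apply: memvZ; apply: up.
Qed.

End StableSubspaces.

(** * Characters *)

(** An intertwiner is conjugation by a pair of mutually inverse, possibly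
    rectangular matrices, so that cyclicity of the trace applies before the
    dimensions are known to agree. *)
Lemma equivalent_trace (C : fieldType) (A : algType C) m n
    (rho : {lrmorphism A -> 'M[C]_m}) (sigma : {lrmorphism A -> 'M[C]_n}) :
  equivalent rho sigma -> forall u, \tr (rho u) = \tr (sigma u).
Proof.
case=> T [S TK SK] Trho u.
pose P := \matrix_(i, j) T (delta_mx j 0) i 0 : 'M[C]_(n, m).
have PE v : P *m v = T v.
  rewrite [in RHS](matrix_sum_delta v) linear_sum; apply/colP => i.
  rewrite mxE summxE; apply: eq_bigr => j _.
  by rewrite big_ord1 linearZ !mxE mulrC.
pose Q := \matrix_(i, j) S (delta_mx j 0) i 0 : 'M[C]_(m, n).
have colS j : S (delta_mx j 0) = col j Q by apply/colP => i; rewrite !mxE.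
have PQ : P *m Q = 1%:M.
  apply/matrixP => i j.
  have -> : (P *m Q) i j = (P *m col j Q) i 0.
    by rewrite !mxE; apply: eq_bigr => k _; rewrite !mxE.
  by rewrite -colS PE SK !mxE eqxx andbT.
have Pinj v w : P *m v = P *m w -> v = w :> 'cV[C]_m.
  by rewrite !PE => /(can_inj TK).
have mxeq k (M N : 'M[C]_(k, m)) : (forall v : 'cV[C]_m, M *m v = N *m v) -> M = N.
  move=> MN; apply/matrixP => i j.
  have := congr1 (fun v : 'cV[C]_k => v i 0) (MN (delta_mx j 0)).
  by rewrite -!colE !mxE.
have QP : Q *m P = 1%:M.
  apply: mxeq => v; apply: Pinj.
  by rewrite !mulmxA PQ !mul1mx mulmx1.
have Prho : P *m rho u = sigma u *m P.
  by apply: mxeq => v; rewrite -!mulmxA !PE Trho.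
by rewrite -[rho u]mul1mx -QP -mulmxA Prho mulmxA mxtrace_mulC mulmxA PQ mul1mx.
Qed.

(** * The operators of the representations *)

Section QNotRootOfUnity.
Context {C : numClosedFieldType} {q h : C}.
Hypothesis hE : h ^+ 2 = q.
Hypothesis q_neq0 : q != 0.
Hypothesis q_nru : forall n : nat, (0 < n)%N -> ~~ n.-unity_root q.

Let hn0 : h != 0 := h_neq0 hE q_neq0.

Lemma subVr_neq0 (x : C) : x != 0 -> x ^+ 2 != 1 -> x - x^-1 != 0.
Proof.
move=> x0; apply: contra_neq => /eqP; rewrite subr_eq0 => /eqP xV.
by rewrite expr2 {2}xV mulfV.
Qed.

Lemma q_expn_neq1 n : (0 < n)%N -> q ^+ n != 1.
Proof. by move=> n0; rewrite -subr_eq0 (q_exp_neq1 q_nru). Qed.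

Lemma qD_neq0 : q - q^-1 != 0.
Proof. by rewrite subVr_neq0 // q_expn_neq1. Qed.

Lemma hD_neq0 : h - h^-1 != 0.
Proof. by rewrite subVr_neq0 // hE -[q]expr1 q_expn_neq1. Qed.

Lemma qpow_shift k : qpow h (k.+1%:R - 1 / 2%:R) = h ^+ k.*2.+1.
Proof.
apply: (qpow_half h (z := k.*2.+1)); rewrite -[RHS]/(k.*2.+1%:R).
by rewrite -natr1 -[in RHS]natr1 -mul2n natrM; field.
Qed.

Lemma qpow_shiftN k : qpow h (- k.+1%:R + 1 / 2%:R) = h ^- k.*2.+1.
Proof. by rewrite -[- _ + _]opprK opprD opprK qpowN qpow_shift. Qed.

Lemma qnum_nat_neq0 n : (0 < n)%N -> qnum q h n%:R != 0.
Proof.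
move=> n0; rewrite /qnum qpowN (qpow_nat hE) mulf_neq0 ?invr_neq0 ?qD_neq0 //.
by rewrite subVr_neq0 ?expf_neq0 // -exprM q_expn_neq1 // muln_gt0 n0.
Qed.

Lemma shiftD_neq0 k : h ^+ k.*2.+1 - h ^- k.*2.+1 != 0.
Proof.
by rewrite subVr_neq0 ?expf_neq0 // -exprM mulnC exprM hE q_expn_neq1.
Qed.

Definition nc_eigen (e : bool) k : C :=
  (-1) ^+ e * - ((h ^+ k.*2.+1 + h ^- k.*2.+1) / (q - q^-1)).

Lemma nc_op1E e n : nc_op1 q h e n = diag_mx (\row_i nc_eigen e i).
Proof.
apply/matrixP => i j; rewrite !mxE qpow_shift qpow_shiftN eqSS.
rewrite -[(i == j :> nat)]/(i == j) /nc_eigen.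
by case: eqVneq => [->|_]; rewrite ?mulr1 ?mulr1n // !mulr0.
Qed.

(** x + 1/x = y + 1/y forces y/x = 1 or x y = 1.  For x = h ^ (2k+1) and
    y = h ^ (2l+1) with k <= l these are q ^ (l-k) = 1 and q ^ (k+l+1) = 1, so
    that k = l. *)
Lemma nc_eigen_inj e : injective (nc_eigen e).
Proof.
suff le k l : (k <= l)%N -> nc_eigen e k = nc_eigen e l -> k = l.
  move=> k l kl; have [/le -> //|/ltnW/le /(_ (esym kl)) //] := leqP k l.
move=> kl /(mulfI _)/=; rewrite signr_eq0 => /(_ isT)/oppr_inj.
move/(mulIf (invr_neq0 qD_neq0)) => E.
have hk m : h ^+ m != 0 by rewrite expf_neq0.
have {E} : (1 - q ^+ (l - k)) * (q ^+ (k + l).+1 - 1) = 0.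
  have -> : q ^+ (l - k) = h ^+ l.*2.+1 / h ^+ k.*2.+1.
    rewrite -(subnK kl) in hk *; rewrite addnK doubleD -addnS exprD mulfK //.
    by rewrite -mul2n exprM hE.
  have -> : q ^+ (k + l).+1 = h ^+ k.*2.+1 * h ^+ l.*2.+1.
    rewrite -exprD -hE -exprM; congr (_ ^+ _).
    by rewrite mul2n doubleS doubleD addSn addnS.
  move: E (hk k.*2.+1) (hk l.*2.+1).
  move: (h ^+ k.*2.+1) (h ^+ l.*2.+1) => x y E x0 y0.
  transitivity (y * ((x + x^-1) - (y + y^-1))).
    by field; rewrite x0 y0.
  by rewrite E subrr mulr0.
move/eqP; rewrite mulf_eq0 (negPf (q_exp_neq1 q_nru _)) // orbF subr_eq0 eq_sym.
case: (posnP (l - k)) => [lk _|/q_expn_neq1/negPf-> //].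
by apply/eqP; rewrite eqn_leq kl -subn_eq0 lk.
Qed.

Lemma iquot_neq0 (a b : C) : a != 0 -> b != 0 -> 'i * (a / b) != 0.
Proof. by move=> a0 b0; rewrite !mulf_neq0 ?invr_neq0 ?neq0Ci. Qed.

(** The numerators at |k> are [n - k], which vanishes for no k < n, and
    [n + k - 1], which vanishes for no k > 1. *)
Lemma nc_op2_neq0 e s n (i j : 'I_n) : i.+1 = j ->
  (nc_op2 q h e s n i j != 0) && (nc_op2 q h e s n j i != 0).
Proof.
move=> ij; rewrite !mxE !mulf_eq0 !signr_eq0 /= /nc_I2 -ij.
have nn : (i.+1 < n)%N by rewrite ij.
have num_down_neq0 : qnum q h (n%:R + i.+2%:R - 1) != 0.
  by rewrite -[i.+2%:R]natr1 addrA addrK -natrD qnum_nat_neq0 // addnS.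
have num_up_neq0 : qnum q h (n%:R - i.+1%:R) != 0.
  by rewrite -natrB 1?ltnW // qnum_nat_neq0 // subn_gt0.
apply/andP; split.
  rewrite /= !mxE /= ltn_eqF // mulr0 add0r eqxx mulr1 qpow_shift qpow_shiftN.
  exact/iquot_neq0/shiftD_neq0.
case: ifP => [/eqP[i0]|i0]; rewrite !mxE -ij.
  rewrite i0 in num_up_neq0 *; rewrite mulr0 add0r mulr1 qpowN qpow_1half.
  exact/iquot_neq0/hD_neq0.
rewrite eqxx mulr1 gtn_eqF ?mulr0 ?addr0 ?qpow_shift ?qpow_shiftN; last by [].
exact/iquot_neq0/shiftD_neq0.
Qed.

Lemma rep_nc_irreducible e s p : irreducible (rep_nc hE q_neq0 q_nru e s p).
Proof.
split=> // W W_stable.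
have [E1 E2] := rep_ncE hE q_neq0 q_nru e s p.
have d_inj : injective ((\row_(i < p.+1) nc_eigen e i) 0).
  by move=> i j; rewrite !mxE => /nc_eigen_inj/val_inj.
apply: (stable_tridiagonal d_inj) (@nc_op2_neq0 e s p.+1) => v vW.
  by rewrite -nc_op1E -E1 W_stable.
by rewrite -E2 W_stable.
Qed.

(** Up to signs, the trace of I_1 and also that of I_2. *)
Definition nc_trace n : C := qnum q h n%:R / (h - h^-1).

Lemma nc_trace_neq0 n : (0 < n)%N -> nc_trace n != 0.
Proof. by move=> n0; rewrite mulf_neq0 ?invr_neq0 ?hD_neq0 ?qnum_nat_neq0. Qed.

Lemma nc_op1_trace e n : \tr (nc_op1 q h e n) = - ((-1) ^+ e * nc_trace n).
Proof.
rewrite nc_op1E mxtrace_diag; under eq_bigr do rewrite mxE.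
rewrite -mulr_sumr -mulrN sumrN -mulr_suml; congr (_ * - _).
rewrite /nc_trace /qnum qpowN (qpow_nat hE) mulrAC; congr (_ / _).
apply: (canRL (mulfK hD_neq0)).
(* Multiplied by h - 1/h, the sum of the eigenvalues telescopes. *)
elim: n => [|n IHn]; first by rewrite big_ord0 mul0r expr0 invr1 subrr.
rewrite big_ord_recr /= mulrDl IHn -hE -!exprM !mul2n doubleS !exprS.
by field; rewrite hn0 expf_neq0.
Qed.

Lemma nc_op2_trace e s n :
  \tr (nc_op2 q h e s n.+1) = (-1) ^+ e * ((-1) ^+ s * nc_trace n.+1).
Proof.
rewrite mxtraceZ; congr (_ * _); rewrite /mxtrace big_ord_recl big1 ?addr0.
  by rewrite !mxE /= mulr0 addr0 mulr1 qpowN qpow_1half.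
move=> i _; rewrite !mxE /= eqSS.
by rewrite ltn_eqF ?gtn_eqF ?mulr0 ?addr0 //= lift0.
Qed.

Lemma cl_op2_trace d : \tr (cl_op2 q h d) = 0.
Proof.
have shiftF (m x : rat) : x != 0 -> (m + x == m) = false.
  by move=> x0; rewrite -subr_eq0 addrAC subrr add0r (negPf x0).
rewrite /mxtrace big1 // => i _; rewrite !mxE !shiftF //.
by rewrite !mulr0 subrr mulr0.
Qed.

Lemma rep_nc_inequivalent e s e' s' p p' : (e, s, p) <> (e', s', p') ->
  ~ equivalent (rep_nc hE q_neq0 q_nru e s p) (rep_nc hE q_neq0 q_nru e' s' p').
Proof.
move=> ne /equivalent_trace tr; apply: ne.
have [E1 E2] := rep_ncE hE q_neq0 q_nru e s p.
have [E1' E2'] := rep_ncE hE q_neq0 q_nru e' s' p'.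
have := tr 1; rewrite !rmorph1 !mxtrace1 => /eqP; rewrite eqr_nat => /eqP[pp].
subst p'; have c0 := nc_trace_neq0 _ (ltn0Sn p).
have := tr (uI1 h); rewrite E1 E1' !nc_op1_trace.
move=> /oppr_inj/(mulIf c0)/signr_inj ee; subst e'.
have := tr (uI2 h); rewrite E2 E2' !nc_op2_trace.
by move=> /(mulfI _); rewrite signr_eq0 => /(_ isT)/(mulIf c0)/signr_inj ->.
Qed.

Lemma rep_cl_nc_inequivalent d e s p :
  ~ equivalent (rep_cl hE q_neq0 q_nru d) (rep_nc hE q_neq0 q_nru e s p).
Proof.
move=> /equivalent_trace/(_ (uI2 h)).
have [_ ->] := rep_clE hE q_neq0 q_nru d.
have [_ ->] := rep_ncE hE q_neq0 q_nru e s p.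
rewrite nc_op2_trace cl_op2_trace => /esym/eqP.
by rewrite 2!mulf_eq0 !signr_eq0 (negPf (nc_trace_neq0 _ (ltn0Sn p))).
Qed.

End QNotRootOfUnity.

Theorem theorem1 (R : realType) (q qh : R[i]) (qhE : qh ^+ 2 = q) (q_neq0 : q != 0)
    (q_nru : forall n : nat, (0 < n)%N -> ~~ n.-unity_root q) :
  [/\ forall (e s : bool) (p : nat), irreducible (rep_nc qhE q_neq0 q_nru e s p),
      forall (e s e' s' : bool) (p p' : nat), (e, s, p) <> (e', s', p') ->
        ~ equivalent (rep_nc qhE q_neq0 q_nru e s p)
                     (rep_nc qhE q_neq0 q_nru e' s' p')
    & forall (d : nat) (e s : bool) (p : nat),
        ~ equivalent (rep_cl qhE q_neq0 q_nru d) (rep_nc qhE q_neq0 q_nru e s p)].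
Proof.
split; first exact: rep_nc_irreducible.
- exact: rep_nc_inequivalent.
- exact: rep_cl_nc_inequivalent.
Qed.
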